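(* Let $p$ be a prime. For all integers $n,m,k\geq 0$, $$A_{n+p^m+k,\,k}\equiv mA_{n+k,k}+A_{n+k+1,k}\pmod p.$$
   Context: A partition of a finite set is a collection of nonempty, pairwise disjoint subsets (blocks) whose union is the set; a singleton of a partition is a block with exactly one element. For integers $0\leq k\leq n$, $A_{n,k}$ denotes the number of partitions of $\{1,2,\dots,n+1\}$ whose largest singleton is $k+1$ (i.e. $\{k+1\}$ is a block and no $j>k+1$ forms a singleton block). *)

(* Defs.v *)
From mathcomp Require Import all_boot.

Set Implicit Arguments.
Unset Strict Implicit.
Unset Printing Implicit Defensive.

(* The set {1, ..., N} is represented by 'I_N, with i : 'I_N standing for the
   element i + 1. *)

Definition is_largest_singleton (N : nat) (P : {set {set 'I_N}}) (i : 'I_N) :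
    bool :=
  ([set i] \in P) && [forall j : 'I_N, (i < j) ==> ([set j] \notin P)].

(* The ordinal of value k stands for k + 1; the count is 0 when n < k, a case
   outside the intended domain k <= n. *)
Definition A (n k : nat) : nat :=
  #|[set P : {set {set 'I_n.+1}} | partition P [set: 'I_n.+1] &
       [exists i : 'I_n.+1, (val i == k) && is_largest_singleton P i]]|.

(* Main.v *)
Require Import Defs.
From HB Require Import structures.
From mathcomp Require Import all_boot.
From mathcomp Require Import ssralg poly zmodp finfield.

Set Implicit Arguments.
Unset Strict Implicit.
Unset Printing Implicit Defensive.

(** Deleting the singleton k + 1 identifies [A n k] with the number of partitions
    of an n-set none of whose singletons lies in a fixed (n - k)-subset.  Let L be
    the linear functional on polynomials sending X^n to the Bell number B_n.  By
    inclusion-exclusion, [A n k] is L((X - 1)^(n-k) X^k).  The Bell recurrence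
    says L(X q(X)) = L(q(X + 1)), hence L(X (X - 1) ... (X - n + 1) q(X)) is
    L(q(X + n)).  Modulo p, taking n = p gives L((X^p - X) q) = L(q), so inside L
    one may replace X^p by X + 1, then X^(p^m) by X + m by iterating Frobenius,
    and (X - 1)^(p^m) by m + (X - 1). *)

(** * Counting set partitions by removing one block *)

Section PartitionCounts.

Variable T : finType.
Implicit Types (D S B : {set T}) (P : {set {set T}}).

Definition partitions D := [set P | partition P D].

Definition partitions_avoiding D S :=
  [set P in partitions D | [forall x in S, [set x] \notin P]].

(** Removing [B] and adding it back are inverse bijections. Since [B] is nonempty, it cannot be a
    block of a partition of [D :\: B]. *)
Lemma card_partitions_with_block D B (Q : pred {set {set T}}) :
    B != set0 -> B \subset D ->
  #|[set P in partitions D | (B \in P) && Q (P :\ B)]| =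
  #|[set P in partitions (D :\: B) | Q P]|.
Proof.
move=> B0 sBD.
have nB P : partition P (D :\: B) -> B \notin P.
  move=> pP; apply/negP => /(partitionS pP).
  by rewrite subsetD -setI_eq0 setIid (negPf B0) andbF.
rewrite -[RHS](@card_in_imset _ _ (fun P => B |: P)); last first.
  move=> P1 P2; rewrite !inE => /andP[p1 _] /andP[p2 _] e.
  by rewrite -(setU1K (nB _ p1)) e setU1K ?nB.
apply: eq_card => P; rewrite !inE; apply/idP/imsetP => [/and3P[pP BP QP]|].
  by exists (P :\ B); rewrite ?setD1K // !inE QP partitionD1.
case=> P'; rewrite !inE => /andP[pP' QP'] ->.
have dB : [disjoint B & D :\: B].
  by rewrite -setI_eq0 setIDA setIC -setIDA setDv setI0.
rewrite setU1K ?nB // QP' setU11 /= andbT.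
have -> : D = B :|: (D :\: B) by rewrite -{1}(setID D B) (setIidPr sBD).
exact: partitionU1.
Qed.

Lemma card_partitions0 : #|partitions set0| = 1.
Proof.
rewrite -(cards1 (set0 : {set {set T}})); apply: eq_card => P.
by rewrite !inE partition_set0.
Qed.

(** Partitions are grouped by the complement [E] of the block containing [x]; the other blocks form
    an arbitrary partition of [E]. *)
Lemma card_partitions_rec D x : x \in D ->
  #|partitions D| = \sum_(E : {set T} | E \subset D :\ x) #|partitions E|.
Proof.
move=> xD; rewrite -sum1_card.
rewrite (partition_big (fun P => D :\: pblock P x) (fun E => E \subset D :\ x)).
  apply: eq_bigr => E sE; rewrite sum1_card.
  have xE : x \notin E by apply/negP => /(subsetP sE); rewrite !inE eqxx.
  have sED : E \subset D by apply: subset_trans sE _; apply: subD1set.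
  have xDE : x \in D :\: E by rewrite inE xE.
  have DDE : D :\: (D :\: E) = E by rewrite setDDr setDv set0U; apply/setIidPr.
  have := @card_partitions_with_block D (D :\: E) predT.
  rewrite DDE => /(_ _ (subsetDl _ _)) H.
  transitivity #|[set P in partitions E | predT P]|; last first.
    by apply: eq_card => P; rewrite !inE andbT.
  rewrite -H; last by apply/set0Pn; exists x.
  apply: eq_card => P; rewrite unfold_in /= !inE andbT; apply/andP/andP => -[pP].
    have sb : pblock P x \subset D.
      apply: partitionS (pP) _; apply: pblock_mem.
      by rewrite (cover_partition pP).
    move/eqP=> <-; rewrite setDDr setDv set0U (setIidPr sb); split=> //.
    by apply: pblock_mem; rewrite (cover_partition pP).
  move=> BP; split=> //.
  by rewrite (def_pblock (partition_trivIset pP) BP xDE) DDE.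
move=> P; rewrite inE => pP; rewrite subsetD1 subsetDl !inE mem_pblock.
by rewrite (cover_partition pP) xD.
Qed.

(** Case split on whether [[set x]] is a block. If it is, removing it leaves the condition on [S]
    unchanged, because [x] is outside [S]. *)
Lemma card_partitions_avoidingU1 D S x : x \in D -> x \notin S ->
  #|partitions_avoiding D S| =
  #|partitions_avoiding D (x |: S)| + #|partitions_avoiding (D :\ x) S|.
Proof.
move=> xD xS.
rewrite -(cardsID [set P : {set {set T}} | [set x] \notin P] (partitions_avoiding D S)).
congr (_ + _).
  apply: eq_card => P; rewrite !inE -andbA; congr (_ && _).
  apply/andP/forall_inP => [[/forall_inP aS ax] y|a].
    by rewrite !inE => /predU1P[-> //|/aS].
  split; last by apply: a; rewrite setU11.
  by apply/forall_inP => y yS; apply: a; rewrite inE yS orbT.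
rewrite -(@card_partitions_with_block D [set x]
           (fun P => [forall y in S, [set y] \notin P])) ?sub1set //; last first.
  by apply/set0Pn; exists x; rewrite inE.
apply: eq_card => P; rewrite !inE negbK [RHS]andbCA; congr (_ && (_ && _)).
apply: eq_forallb_in => y yS; rewrite !inE.
suff -> : [set y] != [set x] by [].
by apply: contraNneq xS => /set1_inj <-.
Qed.

End PartitionCounts.

Definition bell n := #|partitions [set: 'I_n]|.

Lemma sum_subsets (T : finType) (D : {set T}) (F : nat -> nat) :
  \sum_(E : {set T} | E \subset D) F #|E| = \sum_(j < #|D|.+1) 'C(#|D|, j) * F j.
Proof.
rewrite (partition_big (fun E : {set T} => inord #|E| : 'I_#|D|.+1) predT) //=.
apply: eq_bigr => j _; rewrite -cards_draws -sum_nat_const.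
apply: eq_big => [E|E /andP[sE /eqP <-]]; last first.
  by rewrite inordK // ltnS subset_leq_card.
rewrite inE; apply: andb_id2l => sE.
by rewrite -val_eqE /= inordK // ltnS subset_leq_card.
Qed.

Lemma card_partitions (T : finType) (D : {set T}) : #|partitions D| = bell #|D|.
Proof.
have [n] := ubnP #|D|; elim: n => // n IHn in T D *.
(* The right-hand side depends on the cardinality alone, so applying [rec] both to [D] and to the
   full set of ['I_#|D|] yields the same sum. *)
have rec (T' : finType) (D' : {set T'}) : 0 < #|D'| -> #|D'| < n.+1 ->
    #|partitions D'| = \sum_(j < #|D'|) 'C(#|D'|.-1, j) * bell j.
  move=> /card_gt0P[x xD] ltD; have cD := cardsD1 x D'.
  rewrite xD add1n in cD; rewrite (card_partitions_rec xD) cD /= -sum_subsets.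
  apply: eq_bigr => E sE; apply: IHn.
  by apply: leq_ltn_trans (subset_leq_card sE) _; rewrite -ltnS -cD.
have [D0|D0] := posnP #|D|; last first.
  by move=> ltD; rewrite /bell !rec // cardsT card_ord.
rewrite D0 (cards0_eq D0) /bell card_partitions0 => _.
have -> : [set: 'I_0] = set0 by apply/setP => -[].
by rewrite card_partitions0.
Qed.

Lemma bell_rec n : bell n.+1 = \sum_(j < n.+1) 'C(n, j) * bell j.
Proof.
have cD : #|[set: 'I_n.+1] :\ ord0| = n.
  by have := cardsD1 ord0 [set: 'I_n.+1]; rewrite inE cardsT card_ord => -[].
have := sum_subsets ([set: 'I_n.+1] :\ ord0) bell; rewrite cD => <-.
rewrite {1}/bell (card_partitions_rec (in_setT ord0)).
by apply: eq_bigr => E _; apply: card_partitions.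
Qed.

Import GRing.Theory.
Local Open Scope ring_scope.

(** * The Bell functional and the counts it computes *)

Section BellFunctional.

Variable R : comNzRingType.
Implicit Types q : {poly R}.

Definition bell_fun q : R := \sum_(i < size q) q`_i * (bell i)%:R.

Lemma bell_fun_wide n q : (size q <= n)%N ->
  bell_fun q = \sum_(i < n) q`_i * (bell i)%:R.
Proof.
move=> le_n; rewrite /bell_fun (big_ord_widen n (fun i => q`_i * (bell i)%:R)) //.
rewrite big_mkcond; apply: eq_bigr => i _.
by case: ltnP => // le_i; rewrite nth_default ?mul0r.
Qed.

Fact bell_fun_is_linear : linear_for *%R bell_fun.
Proof.
(* A common bound on the three sizes lets all sums run over the same range. *)
move=> c q r; pose n := maxn (size (c *: q + r)) (maxn (size q) (size r)).
rewrite !(@bell_fun_wide n) ?leq_max ?leqnn ?orbT // mulr_sumr -big_split /=.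
by apply: eq_bigr => i _; rewrite coefD coefZ mulrDl mulrA.
Qed.

HB.instance Definition _ :=
  GRing.isLinear.Build R {poly R} R *%R bell_fun bell_fun_is_linear.

Lemma bell_funXn n : bell_fun 'X^n = (bell n)%:R.
Proof.
rewrite (@bell_fun_wide n.+1) ?size_polyXn // big_ord_recr big1 /= => [|i _].
  by rewrite coefXn eqxx mul1r add0r.
by rewrite coefXn ltn_eqF // mul0r.
Qed.

(** By linearity [q] may be a monomial; expanding the power of ['X + 1] then gives exactly
    [bell_rec]. *)
Lemma bell_fun_mulX q : bell_fun ('X * q) = bell_fun (q \Po ('X + 1)).
Proof.
rewrite -[q]coefK poly_def mulr_sumr !raddf_sum /=; apply: eq_bigr => i _.
rewrite -scalerAr comp_polyZ !linearZ /= -exprS bell_funXn; congr (_ * _).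
rewrite comp_Xn_poly exprD1n linear_sum bell_rec natr_sum /=.
apply: eq_bigr => j _; rewrite raddfMn /= bell_funXn.
by rewrite natrM mulr_natl.
Qed.

Lemma bell_fun_mul_falling n q :
  bell_fun (\prod_(i < n) ('X - i%:R%:P) * q) = bell_fun (q \Po ('X + n%:R%:P)).
Proof.
elim: n q => [|n IHn] q; first by rewrite big_ord0 mul1r addr0 comp_polyXr.
rewrite big_ord_recl /= subr0 -mulrA bell_fun_mulX comp_polyM.
rewrite rmorph_prod /=.
(* Absorbing the factor ['X] shifts the variable by 1, which turns each remaining ['X - (i + 1)]
   into ['X - i]: a falling factorial with one factor fewer. *)
under eq_bigr => i _.
  rewrite rmorphB /= comp_polyX comp_polyC natrD polyCD polyC1.
  rewrite opprD addrA addrK.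
over.
rewrite IHn -comp_polyA; congr (bell_fun (q \Po _)).
by rewrite comp_polyD comp_polyX -polyC1 comp_polyC -addrA -polyCD natr1.
Qed.

Lemma card_partitions_avoiding (T : finType) (D S : {set T}) : S \subset D ->
  #|partitions_avoiding D S|%:R =
  bell_fun (('X - 1) ^+ #|S| * 'X^(#|D| - #|S|)).
Proof.
have [n] := ubnP #|S|; elim: n => // n IHn in D S *.
have [->|[x xS]] := set_0Vmem S.
  rewrite cards0 subn0 mul1r bell_funXn -card_partitions => _ _; congr _%:R.
  apply: eq_card => P; rewrite !inE; case: partition => //=.
  by apply/forall_inP => y; rewrite inE.
move=> ltS sSD; have xD := subsetP sSD x xS.
have cS := cardsD1 x S; have cD := cardsD1 x D; rewrite xS xD !add1n in cS cD.
have sSx : S :\ x \subset D :\ x by apply: setSD.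
have xSx : x \notin S :\ x by rewrite !inE eqxx.
have := card_partitions_avoidingU1 xD xSx; rewrite (setD1K xS).
move/(congr1 (fun i => i%:R : R)); rewrite natrD => /eqP.
(* With s and d the sizes of [S] and [D], the difference of the two counts corresponds to (X -
   1)^(s-1) X^(d-s+1) - (X - 1)^(s-1) X^(d-s) = (X - 1)^s X^(d-s). *)
rewrite -subr_eq => /eqP <-; rewrite !IHn ?(subset_trans sSx) ?subD1set -?cS //.
rewrite cD cS subSS subSn ?subset_leq_card // -raddfB /=.
by rewrite !exprS mulrCA -mulrA [in RHS]mulrBl mul1r.
Qed.

Lemma A_bell_fun n k : (A (n + k) k)%:R = bell_fun (('X - 1) ^+ n * 'X^k).
Proof.
have ltk : (k < (n + k).+1)%N by rewrite ltnS leq_addl.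
(* [K] is the forced singleton, [S] the [n] larger elements that may not be singletons. *)
pose K := Ordinal ltk; pose S := [set j : 'I_(n + k).+1 | (k < j)%N].
pose D := [set: 'I_(n + k).+1] :\ K.
have cD : #|D| = (n + k)%N.
  by have := cardsD1 K setT; rewrite inE cardsT card_ord => -[].
have cS : #|S| = n.
  rewrite -sum1dep_card -(big_geq_mkord _ _ xpredT (fun=> 1%N)) /=.
  by rewrite sum_nat_const_nat muln1 subSS addnK.
have sSD : S \subset D.
  by apply/subsetP => j; rewrite !inE andbT -val_eqE /= => /gtn_eqF ->.
have := card_partitions_avoiding sSD; rewrite cD cS addKn => <-; congr _%:R.
have K0 : [set K] != set0 by apply/set0Pn; exists K; rewrite inE.
rewrite -(@card_partitions_with_block _ setT [set K]
           (fun P => [forall x in S, [set x] \notin P])) ?subsetT //.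
apply: eq_card => P; rewrite !inE; congr (_ && _).
have eqS : [forall x in S, [set x] \notin P :\ [set K]] =
           [forall j : 'I_(n + k).+1, (k < j)%N ==> ([set j] \notin P)].
  apply: eq_forallb => j; rewrite !inE; case: ltnP => // ltj.
  suff -> : [set j] != [set K] by [].
  by apply: contraTneq ltj => /set1_inj ->; rewrite ltnn.
rewrite eqS; apply/existsP/idP => [[i /andP[/eqP ei]]|h].
  by have -> : i = K by apply: val_inj.
by exists K; rewrite /is_largest_singleton eqxx.
Qed.

End BellFunctional.

(** * Reduction modulo p *)

Section TouchardCongruence.

Variables (p : nat) (p_prime : prime p).
Implicit Types f g q : {poly 'F_p}.

Let pcharP : p \in [pchar {poly 'F_p}].
Proof. by rewrite pchar_poly pchar_Fp. Qed.

Lemma prod_sub_Fp : \prod_(i < p) ('X - (i%:R)%:P) = 'X^p - 'X :> {poly 'F_p}.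
Proof.
transitivity (\prod_(x : 'F_p) ('X - x%:P)); last first.
  by rewrite -finField_genPoly card_Fp.
have mk := big_mkord xpredT (fun i => 'X - (i%:R)%:P : {poly 'F_p}).
(* Rewriting the bound by [Fp_cast] makes the index type literally the ordinal type underlying
   ['F_p]. *)
rewrite -mk -[in index_iota 0 p](Fp_cast p_prime) mk.
by apply: eq_bigr => i _; rewrite natr_Zp.
Qed.

Lemma bell_fun_mulXp q : bell_fun ('X^p * q) = bell_fun (('X + 1) * q).
Proof.
have := bell_fun_mul_falling p q.
rewrite prod_sub_Fp pchar_Fp_0 // addr0 comp_polyXr mulrBl raddfB /=.
by move/eqP; rewrite subr_eq => /eqP ->; rewrite -raddfD /= mulrDl mul1r addrC.
Qed.

(** [bell_fun] is not multiplicative; replacing the factors one at a time works because the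
    hypothesis holds for every cofactor [q]. *)
Lemma bell_fun_mul_expr f g n :
    (forall q, bell_fun (f * q) = bell_fun (g * q)) ->
  forall q, bell_fun (f ^+ n * q) = bell_fun (g ^+ n * q).
Proof.
move=> fg; elim: n => // n IHn q.
by rewrite !exprS -!mulrA fg mulrCA IHn mulrCA.
Qed.

Lemma bell_fun_mulXpn m q : bell_fun ('X^(p ^ m) * q) = bell_fun (('X + m%:R) * q).
Proof.
elim: m q => [|m IHm] q; first by rewrite addr0.
rewrite expnSr exprM (bell_fun_mul_expr _ IHm).
(* Frobenius fixes the constant [m], so (X + m)^p = X^p + m, and X^p is then replaced by X + 1. *)
rewrite -(pFrobenius_autE pcharP) pFrobenius_autD_comm; last exact: mulrC.
rewrite pFrobenius_aut_nat pFrobenius_autE mulrDl raddfD /= bell_fun_mulXp.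
by rewrite -raddfD /= -mulrDl -addrA nat1r.
Qed.

Lemma bell_fun_mulXsub1pn m q :
  bell_fun (('X - 1) ^+ (p ^ m) * q) = bell_fun ((m%:R + ('X - 1)) * q).
Proof.
have -> : ('X - 1) ^+ (p ^ m) = 'X^(p ^ m) - 1 :> {poly 'F_p}.
  elim: m => // m IHm; rewrite expnSr !exprM IHm -!(pFrobenius_autE pcharP).
  by rewrite pFrobenius_autB_comm ?pFrobenius_aut1 //; apply: mulrC.
rewrite mulrBl raddfB /= bell_fun_mulXpn -raddfB /= -mulrBl.
by rewrite addrCA addrA.
Qed.

End TouchardCongruence.

Local Close Scope ring_scope.

Theorem theorem4p3 (p : nat) (hp : prime p) (n m k : nat) :
  A (n + p ^ m + k) k = m * A (n + k) k + A (n + k + 1) k %[mod p].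
Proof.
(* Residues modulo [p] are values of elements of ['F_p], so the congruence becomes an equality in
   that field. *)
rewrite -!(val_Fp_nat hp); congr val.
rewrite natrD natrM (addnAC n k) addn1 !A_bell_fun.
rewrite (addnC n) exprD -mulrA bell_fun_mulXsub1pn // mulrDl raddfD /=.
by rewrite mulr_natl raddfMn mulr_natl exprS mulrA.
Qed.
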